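(* Let $k\ge 2$, let $C$ be a projective $[n,k]_q$ code and let $r$ be an integer with $1\le r\le \begin{bmatrix}k\\1\end{bmatrix}_q$. If $n>\begin{bmatrix}k\\1\end{bmatrix}_q-\alpha_q(k,r)$, then $M(C)>\begin{bmatrix}k\\1\end{bmatrix}_q-r$.
   Context: $\mathbb{F}_q$ is the finite field with $q$ elements. An $[n,k]_q$ linear code $C$ is a $k$-dimensional subspace of $\mathbb{F}_q^n$; all codes are assumed to have effective length $n$, i.e. every coordinate position is non-zero in some codeword. Given a generator matrix $G$ ($k\times n$, rows a basis of $C$) with columns $G_1,\dots,G_n$ (all non-zero), $C$ is called projective if the multiset of points $\langle G_1\rangle,\dots,\langle G_n\rangle$ of $PG(\mathbb{F}_q^k)$ is a set, i.e. these 1-dimensional subspaces are pairwise distinct. The support of a codeword is its set of non-zero coordinate positions. A non-zero codeword of $C$ is minimal if its support does not properly contain the support of another non-zero codeword of $C$. Two codewords are equivalent if one is a non-zero scalar multiple of the other. $M(C)$ denotes the number of pairwise non-equivalent minimal codewords of $C$ (i.e. the number of equivalence classes of minimal codewords). $PG(\mathbb{F}_q^k)$ is the projective space whose points are the 1-dimensional subspaces and whose hyperplanes are the $(k-1)$-dimensional subspaces of $\mathbb{F}_q^k$; a subspace of co-dimension 2 is a $(k-2)$-dimensional subspace of $\mathbb{F}_q^k$. $\begin{bmatrix}k\\1\end{bmatrix}_q=\frac{q^k-1}{q-1}$ is the number of points (and of hyperplanes). For $k\ge 2$ and $1\le r\le \begin{bmatrix}k\\1\end{bmatrix}_q$, $\alpha_q(k,r)$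 denotes the minimum cardinality of a set $\mathcal{S}$ of points of $PG(\mathbb{F}_q^k)$ such that there exist $r$ different hyperplanes $H_1,\dots,H_r$ and $r$ (not necessarily distinct) subspaces $U_1,\dots,U_r$ of co-dimension $2$ with $U_i\le H_i$ for all $1\le i\le r$ and $\bigcup_{i=1}^r (H_i\setminus U_i)\subseteq\mathcal{S}$, where $H_i\setminus U_i$ is the set of points contained in $H_i$ but not in $U_i$. In particular $\alpha_q(2,r)=r$. *)

(* Defs.v *)
From HB Require Import structures.
From mathcomp Require Import all_boot all_order all_algebra.

Set Implicit Arguments.
Unset Strict Implicit.
Unset Printing Implicit Defensive.

Import GRing.Theory.
Local Open Scope ring_scope.

Import VectorInternalTheory.
HB.instance Definition _ (F : finFieldType) (vT : vectType F) :=
  [Finite of {vspace vT} by <:].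

Definition gauss1 (q k : nat) : nat := (q ^ k - 1) %/ (q - 1).

Section ProjectiveGeometry.
Variables (F : finFieldType) (k : nat).
Implicit Types (U H : {vspace 'cV[F]_k}) (S : {set {vspace 'cV[F]_k}}).

Definition points : {set {vspace 'cV[F]_k}} := [set P | \dim P == 1]%N.

Definition points_in U : {set {vspace 'cV[F]_k}} :=
  [set P in points | (P <= U)%VS].

Definition hyperplane H : bool := (\dim H + 1 == k)%N.
Definition codim2 U : bool := (\dim U + 2 == k)%N.

Definition covers_punctured_hyperplanes (r : nat) S : bool :=
  [exists H : {ffun 'I_r -> {vspace 'cV[F]_k}},
   exists U : {ffun 'I_r -> {vspace 'cV[F]_k}},
   [&& injectiveb H,
       [forall i, [&& hyperplane (H i), codim2 (U i) & (U i <= H i)%VS]] &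
       (\bigcup_i (points_in (H i) :\: points_in (U i))) \subset S]].

(* For 2 <= k and 1 <= r <= gauss1 #|F| k, the default value [points] satisfies
   the constraint, so this is the cardinality of an actual minimizer; outside
   this range the value may be meaningless. *)
Definition alpha (r : nat) : nat :=
  #|[arg min_(S < points | (S \subset points)
                           && covers_punctured_hyperplanes r S) #|S|]%N|.

End ProjectiveGeometry.

Section Codes.
Variables (F : finFieldType) (n : nat).
Implicit Types (C : {vspace 'rV[F]_n}) (c : 'rV[F]_n).

(* Codes are required to have effective length n. *)
Definition linear_code (k : nat) C : Prop :=
  \dim C = k /\ forall i : 'I_n, exists2 c, c \in C & c 0 i != 0.

Definition generator_matrix (k : nat) C (G : 'M[F]_(k, n)) : bool :=
  basis_of C [seq row i G | i <- enum 'I_k].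

(* Since <[A *m v]> = <[A *m w]> iff <[v]> = <[w]> for invertible A, the
   condition on the columns does not depend on the generator matrix. *)
Definition projective_code (k : nat) C : Prop :=
  exists2 G : 'M[F]_(k, n), generator_matrix C G
    & injective (fun j : 'I_n => <[col j G]>%VS).

Definition supp c : {set 'I_n} := [set i | c 0 i != 0].

Definition minimal_codeword C c : bool :=
  [&& c \in C, c != 0 &
      ~~ [exists c' : 'rV[F]_n,
            [&& c' \in C, c' != 0 & supp c' \proper supp c]]].

Definition equiv_codeword : rel 'rV[F]_n :=
  [rel c c' | [exists a : F, (a != 0) && (c' == a *: c)]].

Definition num_minimal_codewords C : nat :=
  #|equivalence_partition equiv_codeword [set c | minimal_codeword C c]|.

End Codes.

(* Main.v *)
(** Let X be the set of points spanned by the columns of a generator matrix G.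
    Up to scalars the non-zero codewords u G correspond to the hyperplanes
    H = ker u, and the zero positions of u G are the points of X on H.  If u G is
    not minimal, some non-proportional w satisfies X \cap ker u <= ker w, so X
    misses H \ U for U = ker u \cap ker w, of co-dimension 2.  Having at least r
    non-minimal classes therefore forces the complement of X to be admissible in
    the definition of alpha. *)
Require Import Defs.
From mathcomp Require Import all_boot all_order all_algebra.

Set Implicit Arguments.
Unset Strict Implicit.
Unset Printing Implicit Defensive.

Import GRing.Theory.
Local Open Scope ring_scope.

(** * Counting up to non-zero scalars *)

(* The fibres of [f] on [A] are exactly the punctured lines. *)
Lemma card_projective_imset (F : finFieldType) (m n : nat) (T : finType)
    (A : {set 'M[F]_(m, n)}) (f : 'M[F]_(m, n) -> T) :
    0 \notin A ->
    (forall a v, a != 0 -> v \in A -> a *: v \in A) ->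
    {in A &, forall v w, f v = f w <-> exists2 a, a != 0 & w = a *: v} ->
  #|A| = (#|f @: A| * (#|F| - 1))%N.
Proof.
move=> A0 AZ fP; rewrite -sum1_card (partition_big_imset f) /= -sum_nat_const.
apply: eq_bigr => _ /imsetP[v vA ->].
have v0 : v != 0 by apply: contraNneq A0 => <-.
(* Since [v != 0], distinct scalars give distinct multiples, so the fibre through [v] has as many
   elements as there are non-zero scalars. *)
have inj : injective (fun a : F => a *: v).
  move=> a b /= /eqP; rewrite -subr_eq0 -scalerBl scaler_eq0 (negPf v0) orbF.
  by rewrite subr_eq0 => /eqP.
have -> : (#|F| - 1)%N = #|[set~ (0 : F)]| by rewrite cardsC1 subn1.
rewrite sum1dep_card.
rewrite -(card_imset _ inj); apply: eq_card => w; rewrite inE.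
apply/andP/imsetP => [[wA /eqP fwv]|[a]].
  by have [/(_ (esym fwv))[a a0 ->] _] := fP v w vA wA; exists a; rewrite ?inE.
rewrite !inE => a0 ->; have avA := AZ _ _ a0 vA.
by split=> //; apply/eqP/esym/(fP _ _ vA avA); exists a.
Qed.

Lemma card_field_subn1_gt0 (F : finFieldType) : (0 < #|F| - 1)%N.
Proof. by rewrite subn_gt0 card_finNzRing_gt1. Qed.

Lemma gauss1E (F : finFieldType) (k m : nat) :
  (m * (#|F| - 1) = #|F| ^ k - 1)%N -> gauss1 #|F| k = m.
Proof. by rewrite /gauss1 => <-; rewrite mulnK ?card_field_subn1_gt0. Qed.

Lemma line_eqP (F : fieldType) (V : vectType F) (v w : V) : w != 0 ->
  <[v]>%VS = <[w]>%VS <-> exists2 a, a != 0 & w = a *: v.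
Proof.
move=> w0; split=> [vw | [a a0 ->]].
  have /vlineP[a wE] : w \in <[v]>%VS by rewrite vw memv_line.
  by exists a => //; apply: contraNneq w0 => a0; rewrite wE a0 scale0r.
apply/eqP; rewrite eqEsubv -!memvE; apply/andP; split.
  by rewrite -{1}[v](scalerK a0) memvZ ?memv_line.
by rewrite memvZ ?memv_line.
Qed.

Lemma card_points (F : finFieldType) (k : nat) : #|points F k| = gauss1 #|F| k.
Proof.
apply/esym/gauss1E.
have -> : points F k = (fun v : 'cV[F]_k => <[v]>%VS) @: [set~ (0 : 'cV[F]_k)].
  apply/setP => P; rewrite inE; apply/idP/imsetP => [/eqP P1 | [v]].
    have P0 : P != 0%VS by rewrite -dimv_eq0 P1.
    exists (vpick P); first by rewrite !inE vpick0.
    by apply/eqP; rewrite eq_sym eqEdim -memvE memv_pick dim_vline vpick0 P0 P1.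
  by rewrite !inE => v0 ->; rewrite dim_vline v0.
rewrite -card_projective_imset.
- by rewrite cardsC1 card_mx muln1 subn1.
- by rewrite !inE eqxx.
- by move=> a v a0; rewrite !inE scaler_eq0 negb_or a0.
- by move=> v w _; rewrite !inE; apply: line_eqP.
Qed.

(** * Hyperplanes as kernels of functionals *)

Section KernelHyperplane.
Variables (F : finFieldType) (k : nat).
Implicit Types (u w : 'rV[F]_k) (v : 'cV[F]_k).

Definition ker_functional u : {vspace 'cV[F]_k} :=
  lker (linfun (mulmx u : 'cV[F]_k -> 'cV[F]_1)).

Lemma mem_ker_functional u v : (v \in ker_functional u) = (u *m v == 0).
Proof. by rewrite memv_ker lfunE. Qed.

(** Fix [j] with [u 0 j != 0]. The vectors [u_j e_i - u_i e_j] lie in the kernel of [u]; that [w]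
    kills them means [u_j w_i = u_i w_j], so the ratio is [w_j / u_j]. *)
Lemma ker_functional_sub u w : u != 0 ->
  (ker_functional u <= ker_functional w)%VS -> exists a, w = a *: u.
Proof.
move=> /rV0Pn[j uj] /subvP sub.
exists (w 0 j / u 0 j); apply/rowP => i; rewrite mxE.
pose v : 'cV[F]_k := u 0 j *: delta_mx i 0 - u 0 i *: delta_mx j 0.
have mulv (x : 'rV[F]_k) : x *m v = (u 0 j * x 0 i - u 0 i * x 0 j)%:M.
  rewrite mulmxBr -!scalemxAr -!colE; apply/matrixP => a b.
  by rewrite !ord1 !mxE eqxx mulr1n.
have : v \in ker_functional w.
  apply: sub; rewrite mem_ker_functional mulv.
  by rewrite [u 0 j * _]mulrC subrr raddf0.
rewrite mem_ker_functional mulv -scalemx1 scaler_eq0 oner_eq0 orbF subr_eq0.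
by move=> /eqP wE; rewrite mulrAC [w 0 j * _]mulrC -wE mulrC mulKf.
Qed.

Lemma ker_functional_eqP u w : u != 0 -> w != 0 ->
  ker_functional u = ker_functional w <-> exists2 a, a != 0 & w = a *: u.
Proof.
move=> u0 w0; split=> [uw | [a a0 ->]].
  have [|a wE] := @ker_functional_sub u w u0; first by rewrite uw subvv.
  by exists a => //; apply: contraNneq w0 => a0; rewrite wE a0 scale0r.
apply/vspaceP => v; rewrite !mem_ker_functional -scalemxAl scaler_eq0.
by rewrite (negPf a0).
Qed.

(** Rank-nullity: the image lies in a line and is non-zero, because [u] maps the [j]-th unit vector
    to [u 0 j != 0]. *)
Lemma hyperplane_ker_functional u : u != 0 -> hyperplane (ker_functional u).
Proof.
move=> /rV0Pn[j uj]; rewrite /hyperplane.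
set f := linfun (mulmx u : 'cV[F]_k -> 'cV[F]_1).
have := limg_ker_dim f fullv; rewrite capfv dimvf /dim /= muln1 => e.
rewrite -[X in _ == X]e eqn_add2l eq_sym eqn_leq; apply/andP; split.
  by apply: leq_trans (dimvS (subvf _)) _; rewrite dimvf.
rewrite lt0n dimv_eq0; apply: contraNneq uj => f0.
have : f (delta_mx j 0) \in (f @: fullv)%VS by rewrite memv_img ?memvf.
rewrite f0 memv0 lfunE /= -colE => /eqP/matrixP/(_ 0 0).
by rewrite !mxE => ->.
Qed.

Lemma codim2_cap_ker_functional u w : u != 0 -> w != 0 ->
    (forall a, w != a *: u) ->
  codim2 (ker_functional u :&: ker_functional w)%VS.
Proof.
move=> u0 w0 nuw; rewrite /codim2.
have /eqP Hu := hyperplane_ker_functional u0.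
have /eqP Hw := hyperplane_ker_functional w0.
have kP (V : {vspace 'cV[F]_k}) : (\dim V <= k)%N.
  by apply: leq_trans (dimvS (subvf V)) _; rewrite dimvf /dim /= muln1.
have sumk : \dim (ker_functional u + ker_functional w)%VS = k.
  (* Otherwise the sum is no larger than the kernel of [w], which then contains the kernel of [u],
     making [w] a multiple of [u]. *)
  apply/eqP; rewrite eqn_leq kP /= -{1}Hw addn1 ltnNge; apply/negP => le.
  have /eqP e : ker_functional w == (ker_functional u + ker_functional w)%VS.
    by rewrite eqEdim addvSr le.
  have [|a wE] := @ker_functional_sub u w u0; first by rewrite e addvSl.
  by move: (nuw a); rewrite wE eqxx.
have := dimv_sum_cap (ker_functional u) (ker_functional w).
(* After adding [k] to both sides, the claim is the dimension formula for two subspaces of dimension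
   [k - 1] with sum of dimension [k]. *)
rewrite sumk => e; rewrite -(eqn_add2l k) addnA e -[2%N]/(1 + 1)%N addnACA.
by rewrite Hu Hw.
Qed.

End KernelHyperplane.

(** The minimum is meaningful only if the default [points] is admissible; any admissible [S] ensures
    this, as admissibility passes to larger sets of points. *)
Lemma alpha_le (F : finFieldType) (k r : nat)
    (S : {set {vspace 'cV[F]_k}}) :
    S \subset points F k -> covers_punctured_hyperplanes r S ->
  (alpha F k r <= #|S|)%N.
Proof.
move=> Spts Scov; rewrite /alpha.
case: arg_minnP => [|S' _]; last by apply; rewrite Spts.
rewrite subxx /=; have /existsP[H /existsP[U /and3P[Hinj HU cov]]] := Scov.
apply/existsP; exists H; apply/existsP; exists U; rewrite Hinj HU.
exact: subset_trans cov Spts.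
Qed.

(** * Minimal codewords up to equivalence *)

Section CodeLemmas.
Variables (F : finFieldType) (n : nat).
Implicit Types (C : {vspace 'rV[F]_n}) (c : 'rV[F]_n).

Lemma supp_scale (a : F) c : a != 0 -> supp (a *: c) = supp c.
Proof.
by move=> a0; apply/setP => i; rewrite !inE mxE mulf_eq0 negb_or a0.
Qed.

Lemma minimal_codewordZ C (a : F) c : a != 0 ->
  minimal_codeword C c -> minimal_codeword C (a *: c).
Proof.
move=> a0 /and3P[cC c0 cmin]; apply/and3P; split.
- exact: memvZ.
- by rewrite scaler_eq0 negb_or a0.
- by rewrite supp_scale.
Qed.

Lemma equiv_codewordP c c' :
  reflect (exists2 a, a != 0 & c' = a *: c) (equiv_codeword c c').
Proof.
apply: (iffP existsP) => [[a /andP[a0 /eqP ->]] | [a a0 ->]]; exists a => //.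
by rewrite a0 eqxx.
Qed.

Lemma card_minimal_codewords C :
  #|[set c | minimal_codeword C c]| =
    (num_minimal_codewords C * (#|F| - 1))%N.
Proof.
apply: card_projective_imset => [|a v a0|v w].
- by rewrite inE /minimal_codeword eqxx andbF.
- by rewrite !inE; apply: minimal_codewordZ.
rewrite !inE => vmin wmin; split=> [e | [a a0 ->]].
  apply/equiv_codewordP.
  (* A class contains its own representative (scalar 1), so equal classes put [w] in the class of
     [v]. *)
  suff : w \in [set y in [set c | minimal_codeword C c] |
                 equiv_codeword v y] by rewrite !inE => /andP[].
  rewrite e !inE wmin; apply/equiv_codewordP; exists 1; rewrite ?oner_eq0 //.
  by rewrite scale1r.
apply/setP => y; rewrite !inE; congr (_ && _).
apply/equiv_codewordP/equiv_codewordP => -[b b0 ->].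
  by exists (b / a); rewrite ?mulf_neq0 ?invr_eq0 // scalerA divfK.
by exists (b * a); rewrite ?mulf_neq0 // scalerA.
Qed.

End CodeLemmas.

(** * Codewords as functionals on the columns of [G] *)

Section Generator.
Variables (F : finFieldType) (n k : nat) (C : {vspace 'rV[F]_n}).
Variable G : 'M[F]_(k, n).
Hypothesis genG : generator_matrix C G.

(** Tuple form of the row list in [generator_matrix], as needed for freeness and coordinates. *)
Let rowsG := map_tuple (fun i => row i G) (ord_tuple k).

Let mulmxE (u : 'rV[F]_k) : u *m G = \sum_i u 0 i *: rowsG`_i.
Proof.
rewrite mulmx_sum_row; apply: eq_bigr => i _.
by rewrite -tnth_nth tnth_map tnth_ord_tuple.
Qed.

Lemma mulmx_generator_inj : injective (fun u : 'rV[F]_k => u *m G).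
Proof.
have /freeP fr : free rowsG := basis_free genG.
move=> u w /= /eqP; rewrite -subr_eq0 -mulmxBl mulmxE => /eqP/fr uw.
apply/rowP => i; apply/eqP; rewrite -subr_eq0.
by have := uw i; rewrite !mxE => ->.
Qed.

Lemma mem_codeP c : reflect (exists u : 'rV[F]_k, c = u *m G) (c \in C).
Proof.
have spanC : <<rowsG>>%VS = C := span_basis genG.
apply: (iffP idP) => [cC | [u ->]].
  exists (\row_i coord rowsG i c); rewrite mulmxE.
  rewrite [LHS](@coord_span _ _ _ rowsG) ?spanC //.
  by apply: eq_bigr => i _; rewrite mxE.
rewrite mulmxE -spanC; apply: memv_suml => i _; apply: memvZ.
by apply: memv_span; apply: mem_nth; rewrite size_tuple.
Qed.

Lemma mem_ker_col (u : 'rV[F]_k) (j : 'I_n) :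
  (col j G \in ker_functional u) = ((u *m G) 0 j == 0).
Proof.
rewrite mem_ker_functional colE mulmxA -colE.
apply/eqP/eqP => [/matrixP/(_ 0 0) | e]; first by rewrite !mxE.
by apply/matrixP => a b; rewrite !ord1 [LHS]mxE e mxE.
Qed.

Definition nonminimal_functionals : {set 'rV[F]_k} :=
  [set u | (u != 0) && ~~ minimal_codeword C (u *m G)].

Lemma mulmx_generator_eq0 (u : 'rV[F]_k) : (u *m G == 0) = (u == 0).
Proof.
by rewrite -(inj_eq mulmx_generator_inj u 0) mul0mx.
Qed.

(** The [q^k - 1] non-zero functionals split into those giving minimal codewords and the others.
    Both parts are stable under non-zero scalars, so dividing by [q - 1] counts minimal classes and
    hyperplanes. *)
Lemma card_nonminimal_hyperplanes :
  (num_minimal_codewords C + #|@ker_functional F k @: nonminimal_functionals|)%N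
    = gauss1 #|F| k.
Proof.
apply/esym/gauss1E; rewrite mulnDl -card_minimal_codewords.
rewrite -card_projective_imset; first 1 last.
- by rewrite inE eqxx.
- move=> a u a0; rewrite !inE scaler_eq0 negb_or a0 => /andP[-> /=].
  apply: contra => /(minimal_codewordZ (invr_neq0 a0)).
  by rewrite scalemxAl scalerA mulVf // scale1r.
- move=> u w; rewrite !inE => /andP[u0 _] /andP[w0 _].
  exact: ker_functional_eqP.
pose Mu := [set u : 'rV[F]_k | minimal_codeword C (u *m G)].
have -> : [set c | minimal_codeword C c] = (fun u => u *m G) @: Mu.
  apply/setP => c; rewrite inE; apply/idP/imsetP => [cmin | [u]].
    have /and3P[/mem_codeP[u cE] _ _] := cmin.
    by exists u; rewrite ?inE -?cE.
  by rewrite inE => umin ->.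
rewrite (card_imset _ mulmx_generator_inj).
have -> : (#|F| ^ k - 1)%N = #|[set~ (0 : 'rV[F]_k)]|.
  by rewrite cardsC1 card_mx mul1n subn1.
rewrite -[RHS](cardsID Mu); congr addn; apply: eq_card => u; rewrite !inE //.
  apply/idP/andP => [umin | []//]; split=> //.
  by have /and3P[_] := umin; rewrite mulmx_generator_eq0.
by rewrite andbC.
Qed.

Lemma nonminimal_punctured_hyperplane (u : 'rV[F]_k) :
    u \in nonminimal_functionals ->
  exists U, [/\ codim2 U, (U <= ker_functional u)%VS &
    forall j, col j G \in ker_functional u -> col j G \in U].
Proof.
rewrite inE /minimal_codeword mulmx_generator_eq0 => /andP[u0].
rewrite u0 /= andbC negb_and negbK => /orP[|/mem_codeP[]]; last by exists u.
case/existsP=> _ /and3P[/mem_codeP[w ->]]; rewrite mulmx_generator_eq0 => w0 prop.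
exists (ker_functional u :&: ker_functional w)%VS; split.
(* Proportional codewords have equal supports, which the proper inclusion excludes. *)
- apply: codim2_cap_ker_functional => // a; apply: contraTneq prop => wE.
  have a0 : a != 0 by apply: contraNneq w0 => a0; rewrite wE a0 scale0r.
  by rewrite wE -scalemxAl supp_scale // properxx.
- exact: capvSl.
- move=> j uj; rewrite memv_cap uj /= mem_ker_col.
  have /subsetP/(_ j) := proper_sub prop; rewrite !inE => sub.
  by apply: contraTT uj; rewrite mem_ker_col; apply: sub.
Qed.

End Generator.

(* The bound, by contraposition *)
Local Close Scope ring_scope.

Theorem proposition3p2 (F : finFieldType) (k n r : nat)
    (C : {vspace 'rV[F]_n}) (k_ge2 : 2 <= k)
    (C_code : linear_code k C) (C_proj : projective_code k C)
    (r_bounds : 1 <= r <= gauss1 #|F| k)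
    (n_large : n > gauss1 #|F| k - alpha F k r) :
  num_minimal_codewords C > gauss1 #|F| k - r.
Proof.
have [G genG colG_inj] := C_proj; have [_ C_eff] := C_code.
have /andP[_ r_le] := r_bounds.
rewrite ltnNge; apply/negP => few; move: n_large; rewrite ltnNge => /negP; apply.
pose HB := @ker_functional F k @: nonminimal_functionals C G.
(* The upper bound on [r] makes the truncated [gauss1 #|F| k - r] a true difference. *)
have r_HB : r <= #|HB|.
  rewrite -(leq_add2l (num_minimal_codewords C)).
  by rewrite (card_nonminimal_hyperplanes genG) addnC -leq_subRL.
pose X : {set {vspace 'cV[F]_k}} := [set <[col j G]>%VS | j : 'I_n].
have cardX : #|X| = n by rewrite card_imset // card_ord.
have Xpts : X \subset points F k.
  apply/subsetP => _ /imsetP[j _ ->]; rewrite inE dim_vline.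
  (* Effective length: a codeword non-zero at [j] shows that column [j] is non-zero and spans a
     point. *)
  have [c /(mem_codeP genG)[u ->]] := C_eff j.
  by rewrite -mem_ker_col; case: (eqVneq (col j G) 0%R) => // ->; rewrite mem0v.
have alpha_bound : alpha F k r <= gauss1 #|F| k - n.
  rewrite -card_points -cardX -cardsDS //; apply: alpha_le; first exact: subsetDl.
  (* Any [r] distinct members of [HB] would do; the first [r] in its enumeration are taken. *)
  pose H := [ffun i : 'I_r => enum_val (widen_ord r_HB i)].
  have Hin i : exists U, [/\ hyperplane (H i), codim2 U, (U <= H i)%VS &
      forall j, col j G \in H i -> col j G \in U].
    have : H i \in HB by rewrite ffunE enum_valP.
    case/imsetP=> u uB ->.
    have [U [U2 sUH UX]] := nonminimal_punctured_hyperplane genG uB.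
    exists U; split=> //; apply: hyperplane_ker_functional.
    by move: uB; rewrite inE => /andP[].
  have [U UP] := fin_all_exists Hin.
  apply/existsP; exists H; apply/existsP; exists [ffun i => U i].
  apply/and3P; split.
  - apply/injectiveP => i j; rewrite !ffunE => /enum_val_inj/(congr1 val) /= e.
    exact: val_inj.
  - apply/forallP => i; rewrite [[ffun i => U i] i]ffunE; apply/and3P.
    by have [] := UP i.
  apply/bigcupsP => i _; apply/subsetP => P; rewrite !inE ffunE.
  (* If [P] on [H i] were spanned by a column, that column would lie in [U i], contrary to the
     choice of [P]. *)
  case/andP=> nPU /andP[P1 PH]; rewrite P1 andbT; rewrite P1 /= in nPU.
  apply: contra nPU => /imsetP[j _ PE]; move: PH; rewrite PE -!memvE.
  by have [_ _ _] := UP i; apply.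
(* Exchanging [n] and [alpha F k r] across truncated subtraction requires both to be at most the
   number of points; for [n] this is [Xpts]. *)
rewrite leq_subRL; last by rewrite (leq_trans alpha_bound) ?leq_subr.
by rewrite addnC -leq_subRL // -cardX -card_points subset_leq_card.
Qed.
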